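(* Let $X$ be a non-empty set, let $f,g$ be permutations of $X$ with $fg=gf$, and let $(X,r)$ be the Lyubashenko solution $r(x,y)=(f(y),g(x))$ for $x,y\in X$. If $(X,r)$ satisfies min-con, then $(X,r)$ is finite, i.e. $X$ is a finite set.
   Context: A solution (of the Yang–Baxter equation) is a pair $(X,r)$ with $X$ a non-empty set and $r\colon X\times X\to X\times X$, $r(x,y)=(\lambda_x(y),\rho_y(x))$, such that $r_{12}r_{23}r_{12}=r_{23}r_{12}r_{23}$ on $X^3$, where $r_{12}=r\times\mathrm{id}_X$, $r_{23}=\mathrm{id}_X\times r$, and such that all maps $\lambda_x$ and $\rho_x$ are bijective (non-degeneracy). For commuting permutations $f,g$ of $X$, the map $r(x,y)=(f(y),g(x))$ gives a solution, called a Lyubashenko solution. A congruence of $(X,r)$ is an equivalence relation $\sim$ on $X$ such that $\overline{r}([x],[y])=([\lambda_x(y)],[\rho_y(x)])$ is well defined on $X/{\sim}$ and $(X/{\sim},\overline r)$ is a (non-degenerate) solution. $(X,r)$ satisfies min-con if the set of its congruences, ordered by inclusion (as subsets of $X\times X$), satisfies the minimal condition. *)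

(* Defs.v *)
From mathcomp Require Import all_boot.
From mathcomp Require Import boolp classical_sets functions cardinality.
From Stdlib Require Import RelationClasses.

Set Implicit Arguments.
Unset Strict Implicit.
Unset Printing Implicit Defensive.

Local Open Scope classical_set_scope.

(* X^3 is encoded as (X * X) * X. *)
Definition r12 (X : Type) (r : X * X -> X * X) (t : X * X * X) : X * X * X :=
  (r t.1, t.2).

Definition r23 (X : Type) (r : X * X -> X * X) (t : X * X * X) : X * X * X :=
  let: (x, y, z) := t in
  let: (y', z') := r (y, z) in (x, y', z').

(* r (x, y) = (lambda r x y, rho r y x) *)
Definition lambda (X : Type) (r : X * X -> X * X) (x y : X) : X := (r (x, y)).1.

Definition rho (X : Type) (r : X * X -> X * X) (y x : X) : X := (r (x, y)).2.

Definition nondegenerate (X : Type) (r : X * X -> X * X) : Prop :=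
  forall x, bijective (lambda r x) /\ bijective (rho r x).

Record solution (X : Type) (r : X * X -> X * X) : Prop := Solution {
  solution_nonempty : [set: X] !=set0;
  solution_braid :
    r12 r \o r23 r \o r12 r =1 r23 r \o r12 r \o r23 r;
  solution_nondegenerate : nondegenerate r
}.

Definition lyubashenko (X : Type) (f g : X -> X) (p : X * X) : X * X :=
  (f p.2, g p.1).

Lemma lyubashenko_solution (X : Type) (f g : X -> X) :
  [set: X] !=set0 -> bijective f -> bijective g -> f \o g = g \o f ->
  solution (lyubashenko f g).
Proof.
move=> X0 bf bg fg; split=> // -[[x y] z]; rewrite /r12 /r23 /lyubashenko /=.
by rewrite -[f (g y)]/((f \o g) y) fg.
Qed.

Definition eqclass (X : Type) (E : set (X * X)) (x : X) : set X :=
  [set y | E (x, y)].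

(* X / E as the type of equivalence classes of E. *)
Definition quotient (X : Type) (E : set (X * X)) : Type :=
  set_type (range (eqclass E)).

Definition quot_class (X : Type) (E : set (X * X)) (x : X) : quotient E :=
  exist _ (eqclass E x) (mem_set (imageT (eqclass E) x)).

(* Existence of rbar is the well-definedness of the induced map on X / E; rbar
   is then unique, since every element of X / E is some quot_class E x. *)
Definition congruence (X : Type) (r : X * X -> X * X) (E : set (X * X)) : Prop :=
  Equivalence (fun x y => E (x, y)) /\
  exists rbar : quotient E * quotient E -> quotient E * quotient E,
    (forall x y, rbar (quot_class E x, quot_class E y) =
       (quot_class E (lambda r x y), quot_class E (rho r y x))) /\
    solution rbar.

Definition minimal_condition (T : Type) (F : set (set T)) : Prop :=
  forall G : set (set T), G `<=` F -> G !=set0 ->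
    exists2 A, G A & forall B, G B -> B `<=` A -> B = A.

Definition min_con (X : Type) (r : X * X -> X * X) : Prop :=
  minimal_condition [set E | congruence r E].

(* Main.v *)
Require Import Defs.
From mathcomp Require Import all_boot all_algebra.
From mathcomp Require Import zify ring.
From mathcomp Require Import boolp classical_sets functions cardinality.
From Stdlib Require Import RelationClasses.

(** The congruences of a Lyubashenko solution include all equivalence relations
    invariant under the action of the abelian group A generated by f and g.
    Minimality among the orbit relations of the subgroups A^n gives n with
    A^n x = A^(2n) x for all x. Then the stabiliser of x, viewed as a sublattice
    of Z^2, contains two vectors congruent to (n, 0) and (0, n) modulo 2n; their
    determinant is n^2 times an odd number, so the orbit of x is finite. If X
    were infinite, take a minimal congruence among those collapsing one infinite
    invariant set U to a point: removing a (finite) orbit from U contradicts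
    minimality. *)

Local Open Scope classical_set_scope.

(** * Quotients of Lyubashenko solutions *)

Section Quotient.
Variables (X : Type) (E : set (X * X)).
Hypothesis E_equiv : Equivalence (fun x y => E (x, y)).

Lemma quot_class_eqP x y : quot_class E x = quot_class E y <-> E (x, y).
Proof.
split=> [/(congr1 val)/= exy | Exy].
  by rewrite -[E (x, y)]/(eqclass E x y) exy; apply: (Equivalence_Reflexive y).
apply: val_inj => /=; apply/seteqP; split=> z /= Ez.
  exact: (Equivalence_Transitive _ _ _ (Equivalence_Symmetric _ _ Exy) Ez).
exact: (Equivalence_Transitive _ _ _ Exy Ez).
Qed.

Lemma quot_class_surj (q : quotient E) : exists x, quot_class E x = q.
Proof. by case: q => A /[dup] /set_mem[x _ <-] Ax; exists x; apply: val_inj. Qed.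

Lemma quotient_map (h : X -> X) :
    (forall x y, E (x, y) -> E (h x, h y)) ->
  exists hbar : quotient E -> quotient E,
    forall x, hbar (quot_class E x) = quot_class E (h x).
Proof.
move=> Eh; have [repr reprK] := choice quot_class_surj.
exists (fun q => quot_class E (h (repr q))) => x.
by apply/quot_class_eqP/Eh/quot_class_eqP.
Qed.

Lemma quotient_bijection (h : X -> X) :
    bijective h -> (forall x y, E (x, y) <-> E (h x, h y)) ->
  exists2 hbar : quotient E -> quotient E, bijective hbar &
    forall x, hbar (quot_class E x) = quot_class E (h x).
Proof.
move=> [h' hK h'K] Eh; have [|hb hbE] := quotient_map h.
  by move=> x y /Eh.
have [|hb' hb'E] := quotient_map h'.
  by move=> x y Exy; apply/Eh; rewrite !h'K.
exists hb => //; exists hb' => q; have [x <-] := quot_class_surj q.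
  by rewrite hbE hb'E hK.
by rewrite hb'E hbE h'K.
Qed.

(** The induced solution is the Lyubashenko solution of the permutations induced by [f] and [g].
    Equivalences, not mere implications, let the inverses of [f] and [g] descend as well. *)
Lemma lyubashenko_congruence (f g : X -> X) :
    [set: X] !=set0 -> bijective f -> bijective g -> f \o g = g \o f ->
    (forall x y, E (x, y) <-> E (f x, f y)) ->
    (forall x y, E (x, y) <-> E (g x, g y)) ->
  congruence (lyubashenko f g) E.
Proof.
move=> [x0 _] fb gb fgC Ef Eg; split=> //.
have [fbar fbar_bij fbarE] := quotient_bijection f fb Ef.
have [gbar gbar_bij gbarE] := quotient_bijection g gb Eg.
exists (lyubashenko fbar gbar); split=> [x y|].
  by rewrite /lyubashenko /= fbarE gbarE.
apply: lyubashenko_solution => //; first by exists (quot_class E x0).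
apply/funext => q /=; have [x <-] := quot_class_surj q.
by rewrite fbarE !gbarE fbarE -[f (g x)]/((f \o g) x) fgC.
Qed.

End Quotient.

(** * The action of the group generated by f and g, and its orbit relations *)

Section Action.
Variables (X : Type) (f g : X -> X).
Hypotheses (f_bij : bijective f) (g_bij : bijective g) (fgC : f \o g = g \o f).

Let act a b x := iter a f (iter b g x).

Lemma iter_comm a b x : iter a f (iter b g x) = iter b g (iter a f x).
Proof.
have fg y : f (g y) = g (f y) by rewrite -[f (g y)]/((f \o g) y) fgC.
have fb y : f (iter b g y) = iter b g (f y).
  by elim: b => //= b IH; rewrite fg IH.
by elim: a => //= a ->.
Qed.

Lemma actD a b c d x : act a b (act c d x) = act (a + c) (b + d) x.
Proof. by rewrite /act !iterD -(iter_comm c b). Qed.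

Lemma act_inj a b : injective (act a b).
Proof.
have iter_inj h n : injective h -> injective (iter n h).
  by move=> hi; elim: n => // n IH x y /= /hi /IH.
move=> x y /(iter_inj _ f a (bij_inj f_bij)).
exact: (iter_inj _ g b (bij_inj g_bij)).
Qed.

(* Orbits of the group generated by [f^n] and [g^n]; negative powers are moved
   to the other side to avoid inverses. *)
Definition orbit_rel n : set (X * X) := [set p | exists a b c d,
  act (n * a) (n * b) p.1 = act (n * c) (n * d) p.2].

Lemma orbit_rel_equiv n : Equivalence (fun x y => orbit_rel n (x, y)).
Proof.
split=> [x | x y [a [b [c [d /= e]]]] |
         x y z [a [b [c [d /= e]]]] [a' [b' [c' [d' /= e']]]]].
- by exists 0, 0, 0, 0.
- by exists c, d, a, b.
exists (a + a'), (b + b'), (c + c'), (d + d') => /=.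
rewrite !mulnDr [n * a + _]addnC [n * b + _]addnC -actD e actD.
by rewrite [n * a' + _]addnC [n * b' + _]addnC -actD e' actD.
Qed.

Lemma orbit_rel_act n i j x y :
  orbit_rel n (x, y) <-> orbit_rel n (act i j x, act i j y).
Proof.
split=> -[a [b [c [d /= e]]]]; exists a, b, c, d => /=.
  by rewrite !actD [_ * a + i]addnC [_ * b + j]addnC -actD e actD addnC
    [j + _]addnC.
apply: (@act_inj i j); move: e; rewrite !actD.
by rewrite [_ * a + i]addnC [_ * b + j]addnC [_ * c + i]addnC
  [_ * d + j]addnC.
Qed.

Lemma orbit_rel_act1 n i j x : orbit_rel n (x, act (n * i) (n * j) x).
Proof. by exists i, j, 0, 0; rewrite muln0. Qed.

Lemma orbit_rel_dvd m n : m %| n -> orbit_rel n `<=` orbit_rel m.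
Proof.
move=> /dvdnP[k ->] [x y] [a [b [c [d /= e]]]].
exists (k * a), (k * b), (k * c), (k * d) => /=.
by rewrite !mulnA ![m * k]mulnC.
Qed.

(** * The stabiliser of a point as a subgroup of Z^2 *)

Section Stabilizer.
Import GRing.Theory Num.Theory.
Local Open Scope ring_scope.
Variable x : X.

(* [f^u g^v x = x], with the negative powers moved to the right-hand side. *)
Definition stab (u v : int) := exists a b c d : nat,
  [/\ act a b x = act c d x, u = a%:Z - c%:Z & v = b%:Z - d%:Z].

Lemma stab0 : stab 0 0.
Proof. by exists 0%N, 0%N, 0%N, 0%N. Qed.

Lemma stabD u v u' v' : stab u v -> stab u' v' -> stab (u + u') (v + v').
Proof.
move=> [a [b [c [d [e -> ->]]]]] [a' [b' [c' [d' [e' -> ->]]]]].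
exists (a' + a)%N, (b' + b)%N, (c + c')%N, (d + d')%N; split; [|lia..].
by rewrite -actD e actD addnC [(b' + d)%N]addnC -actD e' actD.
Qed.

Lemma stabN u v : stab u v -> stab (- u) (- v).
Proof.
by move=> [a [b [c [d [e -> ->]]]]]; exists c, d, a, b; split=> //; lia.
Qed.

Lemma stabZ k u v : stab u v -> stab (k * u) (k * v).
Proof.
move=> uv; have stab_nat (m : nat) : stab (m%:Z * u) (m%:Z * v).
  elim: m => [|m IH]; first by rewrite !mul0r; exact: stab0.
  by rewrite intS !mulrDl !mul1r; apply: stabD.
by case: k => m //; rewrite NegzE !mulNr; apply: stabN.
Qed.

Lemma stab_act (a b : nat) : stab a%:Z b%:Z -> act a b x = x.
Proof.
move=> [a' [b' [c [d [e ea eb]]]]]; apply: (@act_inj c d).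
by rewrite actD -e; congr act; lia.
Qed.

(** Cramer's rule: [s * (p, q) - q * (r, s)] is [(D, 0)] and [p * (r, s) - r * (p, q)] is [(0, D)],
    with [D] the determinant. *)
Lemma stab_absz_det p q r s : stab p q -> stab r s ->
  act `|(p * s - q * r)%R|%N 0 x = x /\ act 0 `|(p * s - q * r)%R|%N x = x.
Proof.
move=> pq rs; set D := p * s - q * r.
have D0 : stab D 0.
  by have := stabD _ _ _ _ (stabZ s _ _ pq) (stabZ (- q) _ _ rs);
    congr stab; rewrite /D; ring.
have D1 : stab 0 D.
  by have := stabD _ _ _ _ (stabZ (- r) _ _ pq) (stabZ p _ _ rs);
    congr stab; rewrite /D; ring.
by split; apply: stab_act; rewrite -[0%N%:Z]/(0 : int) abszE;
  case: (ger0P D) => _ //; rewrite -[0 : int]oppr0; apply: stabN.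
Qed.

(** The exponents on the two sides differ by [(i, j)] up to multiples of [n]. *)
Lemma orbit_rel_stab n i j : orbit_rel n (x, act i j x) ->
  exists k l : int, stab (i%:Z + n%:Z * k) (j%:Z + n%:Z * l).
Proof.
move=> [a [b [c [d /= e]]]]; exists (c%:Z - a%:Z), (d%:Z - b%:Z).
exists (n * c + i)%N, (n * d + j)%N, (n * a)%N, (n * b)%N.
by split; [rewrite -actD -e | rewrite PoszD !PoszM; ring ..].
Qed.

End Stabilizer.

(** * Finiteness of orbits with a common period *)

Lemma act_period K x a b m l : act K 0 x = x -> act 0 K x = x ->
  act (a + m * K) (b + l * K) x = act a b x.
Proof.
move=> fK gK; elim: m => [|m IH]; last first.
  by rewrite mulSnr addnA -[b + _]addn0 -actD fK IH.
elim: l => [|l IH]; first by rewrite !addn0.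
by rewrite mulSnr addnA -[a + _]addn0 -actD gK IH.
Qed.

Lemma orbit_finite x K : 0 < K -> act K 0 x = x -> act 0 K x = x ->
  finite_set [set y | orbit_rel 1 (x, y)].
Proof.
move=> K0 fK gK.
apply: (@sub_finite_set _ _ ((fun p => act p.1 p.2 x) @` (`I_K `*` `I_K)));
  last by apply/finite_image/finite_setX; exact: finite_II.
move=> y [a [b [c [d /=]]]]; rewrite !mul1n => e.
(* Here [y] is [f^(a-c) g^(b-d) x]; modulo [K], the natural number [a'] stands for [a - c] and [b']
   for [b - d]. *)
pose a' := a + c * K.-1; pose b' := b + d * K.-1.
exists (a' %% K, b' %% K) => /=; first by split; rewrite /= ltn_mod.
rewrite -(act_period K x _ _ (a' %/ K) (b' %/ K)) // ![_ %% _ + _]addnC.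
rewrite -!divn_eq; apply: (@act_inj c d).
rewrite actD -e (addnCA c) (addnCA d) -!mulnS.
by rewrite prednK // act_period.
Qed.

(** * Collapsing an invariant set to a point *)

Definition collapse (U : set X) : set (X * X) :=
  [set p | p.1 = p.2 \/ U p.1 /\ U p.2].

Lemma collapse_equiv U : Equivalence (fun x y => collapse U (x, y)).
Proof.
split=> [x | x y | x y z]; rewrite /collapse /=; first by left.
- by case=> [-> | []]; [left | right].
- by move=> [-> // | [Ux Uy]] [<- | [_ Uz]]; right.
Qed.

Lemma collapse_invariant (h : X -> X) U : injective h ->
    (forall x, U x <-> U (h x)) ->
  forall x y, collapse U (x, y) <-> collapse U (h x, h y).
Proof.
move=> h_inj Uh x y; rewrite /collapse /=; have := Uh x; have := Uh y.
split=> [[-> | ?] | [/h_inj | ?]]; tauto.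
Qed.

(** * Consequences of the minimal condition *)

Hypotheses (X_nonempty : [set: X] !=set0)
  (X_min_con : min_con (lyubashenko f g)).

Lemma orbit_rel_congruence n : congruence (lyubashenko f g) (orbit_rel n).
Proof.
apply: lyubashenko_congruence => //; first exact: orbit_rel_equiv.
  by move=> x y; exact: (orbit_rel_act n 1 0).
by move=> x y; exact: (orbit_rel_act n 0 1).
Qed.

Lemma collapse_congruence U :
    (forall x, U x <-> U (f x)) -> (forall x, U x <-> U (g x)) ->
  congruence (lyubashenko f g) (collapse U).
Proof.
move=> Uf Ug; apply: lyubashenko_congruence => //.
- exact: collapse_equiv.
- by apply: collapse_invariant => //; exact: bij_inj.
- by apply: collapse_invariant => //; exact: bij_inj.
Qed.

Lemma min_con_orbit_rel :
  exists2 n, 0 < n & orbit_rel n `<=` orbit_rel (n * 2).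
Proof.
(* The index 0 is excluded because [orbit_rel 0] is equality, which would be the minimum and give
   nothing. *)
have [||_ [n n0 <-] min_n] := X_min_con [set orbit_rel n | n in [set n | 0 < n]].
- by move=> _ [n _ <-]; exact: orbit_rel_congruence.
- by exists (orbit_rel 1), 1.
exists n => //; rewrite (min_n (orbit_rel (n * 2))) //.
  by exists (n * 2) => //=; rewrite muln_gt0 n0.
by apply: orbit_rel_dvd; exact: dvdn_mulr.
Qed.

Lemma min_con_orbit_finite x : finite_set [set y | orbit_rel 1 (x, y)].
Proof.
have [n n0 n2n] := min_con_orbit_rel.
(* Since [x] and [f^n x] are related modulo [n], they are related modulo [n * 2]; likewise for
   [g^n x] below. *)
have [k [l f_stab]] := orbit_rel_stab x _ _ _ (n2n _ (orbit_rel_act1 n 1 0 x)).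
have [p [q g_stab]] := orbit_rel_stab x _ _ _ (n2n _ (orbit_rel_act1 n 0 1 x)).
have [] := stab_absz_det x _ _ _ _ f_stab g_stab.
set D := (X in absz X); apply: orbit_finite; rewrite absz_gt0.
(* The second factor is odd, so [D] is nonzero. *)
have -> : D = ((n * n)%:Z * (1 + 2 * (k + q + 2 * (k * q - l * p))))%R.
  by rewrite /D !muln0 !muln1 !PoszM; ring.
by rewrite GRing.mulf_neq0 ?PoszM ?GRing.mulf_neq0 //; lia.
Qed.

Lemma min_con_finite : finite_set [set: X].
Proof.
apply: contrapT => X_inf.
pose infinite_invariant U := [/\ infinite_set U,
  forall x, U x <-> U (f x) & forall x, U x <-> U (g x)].
have [||_ [U [U_inf Uf Ug] <-] U_min] :=
  X_min_con [set collapse U | U in infinite_invariant].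
- by move=> _ [U [_ Uf Ug] <-]; exact: collapse_congruence.
- by exists (collapse setT), setT.
have [u Uu] := infinite_setN0 U_inf.
pose V := U `\` [set y | orbit_rel 1 (u, y)].
have V_inf : infinite_set V.
  by apply: infinite_setD => //; exact: min_con_orbit_finite.
have [v [Uv uv]] := infinite_setN0 V_inf.
(* The orbit of [u] is invariant in both directions, hence so is its complement [V] in [U]. *)
have orbitE i j x : orbit_rel 1 (u, x) <-> orbit_rel 1 (u, act i j x).
  have [_ sy tr] := orbit_rel_equiv 1; have := orbit_rel_act1 1 i j x.
  rewrite !mul1n => xx'; split=> ux; first exact: tr ux xx'.
  exact: tr ux (sy _ _ xx').
have VE : collapse V = collapse U.
  apply: U_min.
    exists V => //; split=> // x.
      by have := Uf x; have := orbitE 1 0 x; rewrite /V /=; tauto.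
    by have := Ug x; have := orbitE 0 1 x; rewrite /V /=; tauto.
  by move=> [x y] [/= -> | [[Ux _] [Uy _]]]; [left | right].
have uu : orbit_rel 1 (u, u) by exact: (orbit_rel_act1 1 0 0).
(* The pair [(u, v)] separates the two relations: [u] is not in [V], and [v] differs from [u] as it
   lies outside the orbit of [u]. *)
have : collapse U (u, v) by right.
by rewrite -VE => -[/= uv' | [[_ /(_ uu)]]//]; apply: uv; rewrite -uv'.
Qed.

End Action.

Theorem theorem4p15 (X : Type) (X_nonempty : [set: X] !=set0) (f g : X -> X)
    (f_bij : bijective f) (g_bij : bijective g) (fgC : f \o g = g \o f)
    (X_min_con : min_con (lyubashenko f g)) :
  finite_set [set: X].
Proof.
exact: min_con_finite f_bij g_bij fgC X_nonempty X_min_con.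
Qed.
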